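(* Let $G=(V,E)$ be a finite connected undirected graph with privacy labels and largest public-cluster $C^*=(V^*,E^* )$ (with at least one edge), and let $v_{x_1},\dots,v_{x_r}$ be the first $r$ samples of the designed random walk started from a seed in $V^*$. Let $$\hat d_{avg}=\frac{r}{\sum_{k=1}^r\frac1{d_{x_k}}}.$$ Then, as $r\to\infty$, $\hat d_{avg}$ converges (almost surely) to $$\tilde d_{avg}=\frac{D^*}{\sum_{v_i\in V^*}\frac{d_i^*}{d_i}}.$$
   Context: $G=(V,E)$, $V=\{v_1,\dots,v_n\}$, is a finite connected undirected (simple) graph; $d_i$ is the degree of $v_i$ in $G$. Each node carries a fixed privacy label, public or private. The public-clusters are the connected components of the subgraph induced by the public nodes; $C^*=(V^*,E^* )$ is the (a fixed) public-cluster with the most nodes. For $v_i\in V^*$, the public-degree is $d_i^*=|\{v_j\in V^*:(v_i,v_j)\in E^*\}|$ (the number of public neighbors of $v_i$ in $G$), and $D^*=\sum_{v_i\in V^*}d_i^*$. Designed random walk: the first sample is a seed $v_{x_1}\in V^*$; given $v_{x_k}$, a neighbor of $v_{x_k}$ in $G$ is chosen uniformly at random, independently and repeatedly, until a public neighbor is obtained, which is the next sample $v_{x_{k+1}}$. Thus $(x_k)$ is a Markov chain on $V^*$ with transition probability $1/d_i^*$ from $v_i$ to each $v_j$ with $(v_i,v_j)\in E^*$. *)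

(* Defs.v *)
From mathcomp Require Import all_boot all_order all_algebra.
From mathcomp Require Import all_classical all_reals all_analysis.

Set Implicit Arguments.
Unset Strict Implicit.
Unset Printing Implicit Defensive.

Import Order.TTheory GRing.Theory Num.Theory.
Import numFieldNormedType.Exports.

Local Open Scope ring_scope.

(* Finite simple graphs are adjacency relations [e] on a finite type of nodes;
   [pub] is the set of public nodes. *)
Section Graph.
Variables (V : finType) (e : rel V).

Definition simple_graph : Prop := symmetric e /\ irreflexive e.

Definition connected_graph : Prop := forall u v : V, connect e u v.

Definition degree (v : V) : nat := #|[pred u | e v u]|.

Definition induced_edge (A : {set V}) : rel V :=
  fun u v => [&& u \in A, v \in A & e u v].

Definition public_cluster (pub C : {set V}) : Prop :=
  exists2 s : V, s \in pub &
    forall v : V, (v \in C) = connect (induced_edge pub) s v.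

Definition largest_public_cluster (pub C : {set V}) : Prop :=
  public_cluster pub C /\
  forall C' : {set V}, public_cluster pub C' -> (#|C'| <= #|C|)%N.

Definition public_degree (C : {set V}) (v : V) : nat :=
  #|[pred u in C | induced_edge C v u]|.

Definition total_public_degree (C : {set V}) : nat :=
  (\sum_(v in C) public_degree C v)%N.

End Graph.

Section Walk.
Variables (V : finType) (e : rel V) (R : realType).
Variables (d : measure_display) (Omega : measurableType d).
Variable P : probability Omega R.

Definition uniform_neighbor (v u : V) : R :=
  if e v u then (degree e v)%:R^-1 else 0.

(* [X k] is the (k+1)-st sample and [Y k m] the (m+1)-st neighbor drawn while
   standing at [X k].  Conditionally on the samples [X 0], ..., [X k], the draws
   [Y k 0], [Y k 1], ... are independent and uniform on the neighbors of [X k];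
   this is written in product form, through the joint law of the first [m]
   draws, so as not to divide by the probability of the conditioning event.
   The next sample is the first public draw; on the (null) event that no draw
   is public, [X k.+1] is unconstrained.  Measurability is with respect to the
   discrete sigma-algebra on the finite type [V].  The seed may be random. *)
Record designed_random_walk (pub C : {set V})
    (X : nat -> Omega -> V) (Y : nat -> nat -> Omega -> V) : Prop := {
  walk_sample_measurable : forall (k : nat) (v : V),
    measurable [set w | X k w = v]%classic;
  walk_draw_measurable : forall (k m : nat) (v : V),
    measurable [set w | Y k m w = v]%classic;
  walk_seed : forall w : Omega, X 0%N w \in C;
  walk_draws : forall (k m : nat) (x : 'I_k.+1 -> V) (y : 'I_m -> V),
    P [set w | (forall i : 'I_k.+1, X i w = x i) /\
               (forall j : 'I_m, Y k j w = y j)]%classic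
    = (P [set w | forall i : 'I_k.+1, X i w = x i]%classic *
       (\prod_(j < m) uniform_neighbor (x ord_max) (y j))%:E)%E;
  walk_step : forall (k m : nat) (w : Omega),
    Y k m w \in pub ->
    (forall j : nat, (j < m)%N -> Y k j w \notin pub) ->
    X k.+1 w = Y k m w
}.

Definition avg_degree_estimator (X : nat -> Omega -> V) (r : nat) (w : Omega)
    : R :=
  r%:R / \sum_(k < r) (degree e (X k w))%:R^-1.

Definition avg_degree_limit (C : {set V}) : R :=
  (total_public_degree e C)%:R /
  \sum_(v in C) (public_degree e C v)%:R / (degree e v)%:R.

End Walk.

(* Main.v *)
Require Import Defs.
From mathcomp Require Import all_boot all_order all_algebra.
From mathcomp Require Import all_classical all_reals all_analysis.
From mathcomp Require Import ring lra.

(* By independence of the draws, the first public neighbour drawn from [v] is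
   uniform among the public neighbours of [v] (a geometric series), so the
   samples form a random walk on [C].  Connectedness of [C] makes the Poisson
   equation [f = g - drift g] solvable for the centred function
   [f v = 1 / degree v - mu], whence the sum of [f] along the walk is a bounded
   term plus a martingale with bounded increments.  The second moment of the
   martingale grows linearly, so Chebyshev and Borel-Cantelli along the times
   [n ^ 2], together with the bounded increments in between, show that it is
   almost surely negligible against time. *)

Import Order.TTheory GRing.Theory Num.Theory.
Import numFieldNormedType.Exports.

Local Open Scope classical_set_scope.
Local Open Scope ring_scope.

(** * Real sequences controlled along the squares *)

Lemma sqrt_floor (r : nat) : exists m, (m ^ 2 <= r < m.+1 ^ 2)%N.
Proof.
elim: r => [|r [m /andP[mr rm]]]; first by exists 0%N.
have [rm1|rm1] := ltnP r.+1 (m.+1 ^ 2); first by exists m; rewrite (leqW mr).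
by exists m.+1; rewrite rm1/= (leq_ltn_trans rm)// ltn_exp2r.
Qed.

Lemma sum_inv_sqr_le {R : realFieldType} (n : nat) :
  \sum_(i < n) ((i.+1 ^ 2)%:R : R)^-1 <= 2.
Proof.
case: n => [|n]; first by rewrite big_ord0.
(* The sharper bound [2 - n.+1%:R^-1] survives induction, since [(n+2)^-2] is at most
   [(n+1)^-1 - (n+2)^-1]. *)
apply: le_trans (_ : 2 - n.+1%:R^-1 <= _); last by rewrite gerBl invr_ge0.
elim: n => [|n IH]; first by rewrite big_ord1 exp1n !invr1; lra.
rewrite big_ord_recr/= (le_trans (lerD IH (lexx _)))//.
rewrite -addrA lerD2l addrC lerBlDr addrC.
have -> : n.+1%:R^-1 - n.+2%:R^-1 = (n.+1 * n.+2)%:R^-1 :> R.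
  rewrite natrM -[n.+2%:R]natr1; field.
  by rewrite nat1r natr1 !pnatr_eq0.
by rewrite lef_pV2 ?posrE ?ltr0n// ler_nat leq_pmul2r.
Qed.

(* Between consecutive squares [m^2] and [(m+1)^2] a sequence with increments at
   most [c] moves by at most [2cm], which is negligible against [m^2]. *)
Lemma cvg_div_squares {R : realType} {S : nat -> R} (b c : R) : 0 <= c ->
  (forall k, `|S k.+1 - S k| <= c) ->
  (forall eps : R, 0 < eps -> \forall n \near \oo,
    `|S (n ^ 2)%N| <= eps * (n ^ 2)%:R + b) ->
  S r / r%:R @[r --> \oo] --> (0 : R).
Proof.
move=> c0 Sc Ssq; have Sinc m j : `|S (m + j)%N - S m| <= c * j%:R.
  elim: j => [|j IH]; first by rewrite addn0 subrr normr0 mulr0.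
  rewrite addnS -(subrK (S (m + j)%N) (S (m + j).+1)) -addrA.
  apply: le_trans (ler_normD _ _) _.
  by rewrite -natr1 mulrDr mulr1 [leRHS]addrC lerD.
apply/cvgr0Pnorm_le => eps eps0; have e2 : 0 < eps / 2 by rewrite divr_gt0.
have [N _ SN] := Ssq _ e2.
(* Once [m >= K], the term [|b| + 2 * c] is at most [eps / 2 * m]. Multiplied by [m], the constant
   and the drift between squares then cost at most half of [eps * r]. *)
pose K := (Num.truncn ((`|b| + 2 * c) / (eps / 2))).+1.
near=> r; have [m /andP[mr rm]] := sqrt_floor r.
have m_ge k : (k ^ 2 <= r)%N -> (k <= m)%N.
  by move=> kr; rewrite -ltnS -(ltn_exp2r _ _ (isT : (0 < 2)%N)) (leq_ltn_trans kr).
have Nm : (N <= m)%N by apply: m_ge; near: r; exact: nbhs_infty_ge.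
have Km : (K <= m)%N by apply: m_ge; near: r; exact: nbhs_infty_ge.
have m0 : (0 < m)%N by exact: leq_trans Km.
have r0 : (0 < r)%N by rewrite (leq_trans _ mr)// expn_gt0 m0.
rewrite normrM normfV normr_nat ler_pdivrMr ?ltr0n//.
have Srm : `|S r - S (m ^ 2)%N| <= c * (2 * m%:R).
  rewrite -[in S r](subnKC mr) (le_trans (Sinc _ _))// ler_wpM2l//.
  rewrite -natrM ler_nat leq_subLR -ltnS (leq_trans rm)//.
  by rewrite -addn1 sqrnD muln1 addnAC !addn1.
have mR : m%:R ^+ 2 <= r%:R :> R by rewrite -natrX ler_nat.
have m1 : 1 <= m%:R :> R by rewrite ler1n.
have Kb : `|b| + 2 * c <= eps / 2 * m%:R.
  rewrite [leRHS]mulrC -ler_pdivrMr//; apply: le_trans (ltW (truncnS_gt _)) _.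
  by rewrite ler_nat.
have := SN m Nm; rewrite natrX /= => Sm.
have := ler_norm b; have := ler_normD (S r - S (m ^ 2)%N) (S (m ^ 2)%N).
rewrite subrK => tri bb.
have b0 := normr_ge0 b.
apply: (le_trans tri); apply: (le_trans (lerD Srm Sm)).
have : (`|b| + 2 * c) * m%:R <= eps / 2 * m%:R ^+ 2.
  by rewrite expr2 mulrA ler_wpM2r// (le_trans _ m1).
have : eps / 2 * m%:R ^+ 2 <= eps / 2 * r%:R by rewrite ler_wpM2l// ltW.
have : `|b| <= `|b| * m%:R by rewrite ler_peMr.
by lra.
Unshelve. all: by end_near.
Qed.

(** * Public-clusters and the Poisson equation of the graph Laplacian *)

Section Cluster.
Context {V : finType} {e : rel V} {pub C : {set V}}.
Hypothesis clusterC : public_cluster e pub C.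

Lemma cluster_sub : C \subset pub.
Proof.
case: clusterC => s spub inC; apply/fintype.subsetP => v.
rewrite inC => /connectP[p + ->]; elim: p s spub {inC} => //= x p IH s spub.
by case/andP=> /and3P[_ xpub _]; exact: IH.
Qed.

Lemma cluster_closed {u v : V} : u \in C -> e u v -> v \in pub -> v \in C.
Proof.
move=> uC euv vpub; have upub := fintype.subsetP cluster_sub _ uC.
case: clusterC => s _ inC; move: uC; rewrite !inC => /connect_trans; apply.
by apply: connect1; rewrite /induced_edge upub vpub.
Qed.

(** Links the draws, which test membership in [pub], to the public-degree, which counts inside [C]:
    a cluster absorbs the public neighbours of its vertices. *)
Lemma induced_edge_cluster {u v : V} : u \in C ->
  induced_edge e C u v = e u v && (v \in pub).
Proof.
move=> uC; rewrite /induced_edge uC /=; apply/andP/andP => -[]; last first.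
  by move=> euv vpub; split=> //; exact: cluster_closed uC euv vpub.
by move=> vC euv; split=> //; exact: (fintype.subsetP cluster_sub).
Qed.

(** Follow a path of public nodes from the root [s]; it never leaves [C], so each of its edges
    preserves [f]. *)
Lemma cluster_const {T : Type} {f : V -> T} :
  (forall u v, induced_edge e C u v -> f u = f v) ->
  forall u v, u \in C -> v \in C -> f u = f v.
Proof.
move=> f_edge; case: (clusterC) => s spub inC.
suff fs v : v \in C -> f s = f v by move=> u v /fs <- /fs <-.
have sC : s \in C by rewrite inC connect0.
rewrite inC => /connectP[p + ->]; elim: p s sC {spub inC} => //= x p IH s sC.
case/andP=> /and3P[_ xpub esx].
rewrite (f_edge s x); first exact/IH/(cluster_closed sC esx).
by rewrite induced_edge_cluster// esx xpub.
Qed.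

Hypothesis e_sym : symmetric e.

Lemma induced_edge_sym (D : {set V}) : symmetric (induced_edge e D).
Proof. by move=> u v; rewrite /induced_edge e_sym andbCA. Qed.

(** By symmetry both ends of an edge of [C] have positive public-degree, so positivity is constant
    along edges and spreads from the given edge to all of [C]. *)
Lemma public_degree_gt0 {v : V} : (exists x y, induced_edge e C x y) ->
  v \in C -> (0 < public_degree e C v)%N.
Proof.
have deg_gt0 x y : induced_edge e C x y -> (0 < public_degree e C x)%N.
  move=> exy; apply/card_gt0P; exists y; rewrite inE /= exy andbT.
  by case/and3P: exy.
case=> x [y exy] vC; have xC : x \in C by case/and3P: exy.
rewrite (@cluster_const _ (fun z => (0 < public_degree e C z)%N) _ v x)//.
  exact: deg_gt0 exy.
by move=> a b ab; rewrite (deg_gt0 _ _ ab) (deg_gt0 b a)// induced_edge_sym.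
Qed.

Lemma public_degree_sum (R : pzSemiRingType) (v : V) :
  (public_degree e C v)%:R = \sum_u (induced_edge e C v u)%:R :> R.
Proof.
rewrite -natr_sum /public_degree -sum1_card big_mkcond /=; congr (_%:R).
apply: eq_bigr => u _; rewrite inE /=.
by case: (boolP (induced_edge _ _ _ _)); rewrite ?andbF// => /and3P[_ -> _].
Qed.

(** Pairing harmonicity with [f] and symmetrizing shows that the Dirichlet energy is zero; each of
    its nonnegative terms vanishes, so [f] agrees across every edge. *)
Lemma dirichlet_eq0 {R : realFieldType} {f : V -> R} :
  (forall v, \sum_u (induced_edge e C v u)%:R * (f v - f u) = 0) ->
  forall u v, u \in C -> v \in C -> f u = f v.
Proof.
move=> harm.
have E0 : \sum_v \sum_u (induced_edge e C v u)%:R * (f v - f u) ^+ 2 = 0.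
  have h1 : \sum_v \sum_u (induced_edge e C v u)%:R * (f v - f u) * f v = 0.
    by apply: big1 => v _; rewrite -mulr_suml harm mul0r.
  have h2 : \sum_v \sum_u (induced_edge e C v u)%:R * (f u - f v) * f u = 0.
    rewrite exchange_big -[RHS]h1; apply: eq_bigr => v _; apply: eq_bigr => u _.
    by rewrite induced_edge_sym.
  rewrite -[RHS]addr0 -[X in _ = X + _]h1 -[X in _ = _ + X]h2 -big_split.
  apply: eq_bigr => v _ /=.
  by rewrite -big_split; apply: eq_bigr => u _ /=; ring.
apply: cluster_const => u v euv.
have ge0 x y : 0 <= (induced_edge e C x y)%:R * (f x - f y) ^+ 2.
  by rewrite mulr_ge0 ?sqr_ge0.
have /psumr_eq0P-/(_ E0 u isT) : forall x, true ->
  0 <= \sum_y (induced_edge e C x y)%:R * (f x - f y) ^+ 2.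
  by move=> x _; apply: sumr_ge0.
move/psumr_eq0P => /(_ (fun y _ => ge0 u y) v isT); rewrite euv mul1r => /eqP.
by rewrite sqrf_eq0 subr_eq0 => /eqP.
Qed.

(* Fredholm alternative for the symmetric graph Laplacian: by [dirichlet_eq0] its
   kernel is spanned, on [C], by the constants. *)
Lemma poisson_equation {R : realFieldType} {h : V -> R} :
  (forall v, v \notin C -> h v = 0) -> \sum_v h v = 0 ->
  exists g : V -> R,
    forall v, h v = \sum_u (induced_edge e C v u)%:R * (g v - g u).
Proof.
move=> h0 hsum; set ie := induced_edge e C.
pose lap (v u : V) : R := (v == u)%:R * (\sum_w (ie v w)%:R) - (ie v u)%:R.
have lapE (f : V -> R) v :
    \sum_u lap v u * f u = \sum_u (ie v u)%:R * (f v - f u).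
  rewrite (eq_bigr (fun u => (v == u)%:R * (\sum_w (ie v w)%:R) * f u
    - (ie v u)%:R * f u)); last by move=> u _; rewrite mulrBl.
  rewrite sumrB (bigD1 v)//= eqxx mul1r.
  rewrite [X in _ + X - _]big1 ?addr0; last first.
    by move=> u; rewrite eq_sym => /negPf ->; rewrite !mul0r.
  by rewrite mulr_suml -sumrB; apply: eq_bigr => u _; rewrite mulrBr.
have lap_sym v u : lap v u = lap u v.
  rewrite /lap [ie u v]induced_edge_sym.
  by case: (eqVneq v u) => [->|_]; rewrite ?mul0r.
pose L : 'M[R]_#|V| := \matrix_(i, j) lap (enum_val i) (enum_val j).
pose H : 'rV[R]_#|V| := \row_i h (enum_val i).
have sumV (F : V -> R) : \sum_v F v = \sum_(i < #|V|) F (enum_val i).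
  by rewrite (reindex _ (onW_bij _ (enum_val_bij V))).
(* [H] is in the row space of [L] iff it annihilates the cokernel. A column of the cokernel is
   harmonic, hence constant on [C], and [h] is supported in [C] with total zero. *)
have : (H <= L)%MS.
  rewrite submxE; apply/eqP/matrixP => i0 j; rewrite !mxE.
  pose f v : R := cokermx L (enum_rank v) j.
  have fcst : forall u v, u \in C -> v \in C -> f u = f v.
    apply: dirichlet_eq0 => v; rewrite -lapE sumV.
    have := mulmx_coker L => /matrixP/(_ (enum_rank v) j); rewrite !mxE => LK.
    by rewrite -[RHS]LK; apply: eq_bigr => i _; rewrite [L _ _]mxE /f enum_valK enum_rankK.
  case: (clusterC) => s spub inC.
  have sC : s \in C by rewrite inC connect0.
  rewrite -[RHS](mul0r (f s)) -[X in _ = X * _]hsum mulr_suml sumV; apply: eq_bigr => i _.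
  rewrite [H _ _]mxE -{2}(enum_valK i) -/(f _).
  have [iC|/h0->] := boolP (enum_val i \in C); last by rewrite !mul0r.
  by rewrite (fcst _ s iC sC).
(* Symmetry of [lap] turns the row identity [H = D *m L] into the Laplacian applied to [D]. *)
case/submxP => D HD; exists (fun v => D 0 (enum_rank v)) => v.
rewrite -lapE sumV; have /matrixP/(_ 0 (enum_rank v)) := HD.
rewrite !mxE enum_rankK => ->; apply: eq_bigr => i _.
by rewrite !mxE enum_rankK enum_valK mulrC lap_sym.
Qed.

End Cluster.

(** * Real-valued probabilities and expectations of finite-valued random variables *)

Section Discrete.
Context {d : measure_display} {Omega : measurableType d} {R : realType}.
Variable P : probability Omega R.

Definition pr (A : set Omega) : R := fine (P A).

Definition discrete {T : finType} (Z : Omega -> T) : Prop :=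
  forall t, measurable [set w | Z w = t].

Lemma prE {A : set Omega} : measurable A -> (pr A)%:E = P A.
Proof. by move=> mA; rewrite fineK// fin_num_measure. Qed.

Lemma pr_ge0 (A : set Omega) : 0 <= pr A.
Proof. exact/fine_ge0/measure_ge0. Qed.

Lemma pr_le {A B : set Omega} : measurable A -> measurable B -> A `<=` B ->
  pr A <= pr B.
Proof.
by move=> mA mB AB; rewrite -lee_fin !prE//; apply: le_measure; rewrite ?inE.
Qed.

Lemma discrete_pred {T : finType} {Z : Omega -> T} (Q : {pred T}) :
  discrete Z -> measurable [set w | Z w \in Q].
Proof.
move=> mZ; rewrite (_ : [set _ | _] = \bigcup_(t in [set` Q]) [set w | Z w = t]).
  by apply: fin_bigcup_measurable => [|t _]; [exact: finite_finpred|exact: mZ].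
by apply/seteqP; split=> w /= => [QZ|[t Qt ->]//]; exists (Z w).
Qed.

Lemma discrete_ffun {n : nat} {T : finType} {Z : 'I_n -> Omega -> T} :
  (forall i, discrete (Z i)) -> discrete (fun w => [ffun i => Z i w]).
Proof.
move=> mZ t; rewrite (_ : [set _ | _] =
  \bigcap_(i in [set: 'I_n]) [set w | Z i w = t i]).
  by apply: fin_bigcap_measurable => // i _; exact: mZ.
apply/seteqP; split=> w /= => [<- i _ /=|Zt]; first by rewrite ffunE.
by apply/ffunP => i; rewrite ffunE; exact: Zt.
Qed.

Lemma pr_setI_pred {T : finType} {Z : Omega -> T} {A : set Omega} (Q : {pred T}) :
  measurable A -> discrete Z ->
  pr (A `&` [set w | Z w \in Q]) = \sum_(t in Q) pr (A `&` [set w | Z w = t]).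
Proof.
move=> mA mZ; apply: EFin_inj; rewrite prE; last first.
  by apply: measurableI => //; exact: discrete_pred.
have mAZ t : measurable (A `&` [set w | Z w = t]) by exact: measurableI.
rewrite (_ : _ `&` _ = \bigcup_(t in [set` Q]) (A `&` [set w | Z w = t])); last first.
  by apply/seteqP; split=> w /= => [[Aw QZ]|[t Qt [Aw ->]]//]; exists (Z w).
rewrite measure_fin_bigcup; [|exact: finite_finpred| |by move=> t _; exact: mAZ].
  2: by move=> t t' _ _ [w [[/= _ ->] [_ ->]]].
rewrite -(bigfs _ (index_enum_uniq T)); last by move=> t _; rewrite mem_index_enum.
by rewrite -sumEFin; apply: eq_bigr => t _; rewrite prE.
Qed.

Lemma pr_pred {T : finType} {Z : Omega -> T} (Q : {pred T}) : discrete Z ->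
  pr [set w | Z w \in Q] = \sum_(t in Q) pr [set w | Z w = t].
Proof.
move=> mZ; rewrite -[X in pr X]setTI pr_setI_pred//.
by apply: eq_bigr => t _; rewrite setTI.
Qed.

Lemma pr_total {T : finType} {Z : Omega -> T} {A : set Omega} : measurable A ->
  discrete Z -> pr A = \sum_t pr (A `&` [set w | Z w = t]).
Proof.
move=> mA mZ; have := pr_setI_pred predT mA mZ.
rewrite (_ : [set w | _] = setT) ?setIT//.
by apply/seteqP; split.
Qed.

(** The expectation of [phi] at [Z], as a finite sum over values in place of an integral. *)
Definition expect {T : finType} (Z : Omega -> T) (phi : T -> R) : R :=
  \sum_t phi t * pr [set w | Z w = t].

Lemma expect_comp {T T' : finType} {Z : Omega -> T} (h : T -> T') (phi : T' -> R) :
  discrete Z -> expect (h \o Z) phi = expect Z (phi \o h).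
Proof.
move=> mZ; rewrite /expect [RHS](partition_big h xpredT)//=.
apply: eq_bigr => t' _.
rewrite (eq_bigr (fun t => phi t' * pr [set w | Z w = t])); last first.
  by move=> t /eqP ->.
rewrite -mulr_sumr; congr (_ * _); rewrite -(pr_pred [pred t | h t == t'])//.
by congr pr; apply/seteqP; split=> w /=; rewrite inE => /eqP.
Qed.

Lemma markov_expect {T : finType} {Z : Omega -> T} {phi : T -> R} (a : R) :
  discrete Z -> (forall t, 0 <= phi t) ->
  a * pr [set w | a <= phi (Z w)] <= expect Z phi.
Proof.
move=> mZ phi0.
rewrite (_ : [set _ | _] = [set w | Z w \in [pred t | a <= phi t]])//.
rewrite pr_pred// mulr_sumr big_mkcond; apply: ler_sum => t _.
rewrite inE; case: ifPn => [ale|_]; first by rewrite ler_wpM2r ?pr_ge0.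
by rewrite mulr_ge0 ?pr_ge0.
Qed.

End Discrete.

(** * From independent draws to the Markov chain on the cluster *)

Section Walk.
Context {V : finType} {e : rel V} {pub C : {set V}}.
Hypothesis e_sym : symmetric e.
Hypothesis clusterC : public_cluster e pub C.
Hypothesis C_edge : exists u v : V, induced_edge e C u v.
Context {R : realType} {d : measure_display} {Omega : measurableType d}.
Context {P : probability Omega R}.
Context {X : nat -> Omega -> V} {Y : nat -> nat -> Omega -> V}.
Hypothesis XY_walk : designed_random_walk e P pub C X Y.

Local Notation Pr := (pr P).

(** Rows outside [C] are zero, so this kernel is stochastic only on [C]. *)
Definition transition (v u : V) : R :=
  (induced_edge e C v u)%:R / (public_degree e C v)%:R.

Lemma transition_ge0 (v u : V) : 0 <= transition v u.
Proof. exact: divr_ge0. Qed.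

Lemma transition_out (v u : V) : u \notin C -> transition v u = 0.
Proof.
by move=> /negPf uC; rewrite /transition /induced_edge uC andbF mul0r.
Qed.

Lemma public_degree_neq0 (v : V) : v \in C -> (public_degree e C v)%:R != 0 :> R.
Proof. by move=> vC; rewrite pnatr_eq0 -lt0n (public_degree_gt0 clusterC e_sym). Qed.

Lemma sum_transition (v : V) : v \in C -> \sum_u transition v u = 1.
Proof.
move=> vC; rewrite -mulr_suml -public_degree_sum.
by rewrite divff// public_degree_neq0.
Qed.

Lemma public_degree_le (v : V) : (public_degree e C v <= degree e v)%N.
Proof.
apply/subset_leq_card/fintype.subsetP => u.
by rewrite !inE => /andP[_ /and3P[]].
Qed.

Lemma degree_neq0 (v : V) : v \in C -> (degree e v)%:R != 0 :> R.
Proof.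
move=> vC; rewrite pnatr_eq0 -lt0n (leq_trans _ (public_degree_le v))//.
exact: (public_degree_gt0 clusterC e_sym).
Qed.

Lemma sum_uniform_neighbor (v : V) : v \in C ->
  \sum_u uniform_neighbor e R v u = 1.
Proof.
move=> vC; rewrite -big_mkcond/= sumr_const -[X in _ *+ X]/(degree e v).
by rewrite -[LHS]mulr_natl divff// degree_neq0.
Qed.

Lemma sum_public_neighbor (v : V) : v \in C ->
  \sum_(u in pub) uniform_neighbor e R v u
  = (public_degree e C v)%:R / (degree e v)%:R.
Proof.
move=> vC; rewrite public_degree_sum mulr_suml big_mkcond.
apply: eq_bigr => u _; rewrite (induced_edge_cluster clusterC)// /uniform_neighbor.
by case: (e v u); case: (u \in pub); rewrite /= ?mul1r ?mul0r.
Qed.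

(** Conditioned on being public, a draw has law [transition v]; the condition is kept as a factor to
    avoid a division. *)
Lemma uniform_neighborE (v u : V) : v \in C -> u \in pub ->
  uniform_neighbor e R v u =
  transition v u * \sum_(z in pub) uniform_neighbor e R v z.
Proof.
move=> vC upub; rewrite sum_public_neighbor// /transition.
rewrite mulrA divfK ?public_degree_neq0//.
rewrite (induced_edge_cluster clusterC)// upub andbT /uniform_neighbor.
by case: (e v u); rewrite ?mul1r ?mul0r.
Qed.

(** Packs the whole past into one finite-valued variable, so that conditioning on it is a finite
    sum. *)
Definition path_to (k : nat) (w : Omega) : {ffun 'I_k.+1 -> V} :=
  [ffun i : 'I_k.+1 => X i w].

Definition draws_to (k m : nat) (w : Omega) : {ffun 'I_m -> V} :=
  [ffun j : 'I_m => Y k j w].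

Lemma path_to_discrete (k : nat) : discrete (path_to k).
Proof. by apply: discrete_ffun => i v; exact: (walk_sample_measurable XY_walk). Qed.

Lemma draws_to_discrete (k m : nat) : discrete (draws_to k m).
Proof. by apply: discrete_ffun => i v; exact: (walk_draw_measurable XY_walk). Qed.

Lemma draws_law (k m : nat) (x : {ffun 'I_k.+1 -> V}) (y : {ffun 'I_m -> V}) :
  Pr ([set w | path_to k w = x] `&` [set w | draws_to k m w = y])
  = Pr [set w | path_to k w = x]
    * \prod_(j < m) uniform_neighbor e R (x ord_max) (y j).
Proof.
have pathE : [set w | path_to k w = x]
    = [set w | forall i : 'I_k.+1, X i w = x i].
  apply/seteqP; split=> w /= => [<- i|wx]; first by rewrite ffunE.
  by apply/ffunP => i; rewrite ffunE wx.
have drawsE : [set w | draws_to k m w = y]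
    = [set w | forall j : 'I_m, Y k j w = y j].
  apply/seteqP; split=> w /= => [<- i|wx]; first by rewrite ffunE.
  by apply/ffunP => i; rewrite ffunE wx.
apply: EFin_inj; rewrite EFinM !prE ?pathE ?drawsE.
- exact: (walk_draws XY_walk).
- by rewrite -pathE; exact: path_to_discrete.
- rewrite -pathE -drawsE; apply: measurableI.
    exact: path_to_discrete.
  exact: draws_to_discrete.
Qed.

(** [F] encodes [m] non-public draws followed by [v]; distributing the product over the sums factors
    the law over the draws. *)
Lemma pr_first_public (k m : nat) (x : {ffun 'I_k.+1 -> V}) (v : V) :
  let u := uniform_neighbor e R (x ord_max) in
  let F (j : 'I_m.+1) := [pred z | if (j < m)%N then z \notin pub else z == v] in
  Pr ([set w | path_to k w = x] `&` [set w | draws_to k m.+1 w \in family F])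
  = Pr [set w | path_to k w = x] * ((\sum_(z | z \notin pub) u z) ^+ m * u v).
Proof.
move=> u F; rewrite pr_setI_pred; [|exact: path_to_discrete|exact: draws_to_discrete].
under eq_bigr do rewrite draws_law.
rewrite -mulr_sumr -(bigA_distr_big_dep F (fun _ z => u z)) big_ord_recr/=.
congr (_ * (_ * _)).
  rewrite (eq_bigr (fun=> \sum_(z | z \notin pub) u z)); last first.
    by move=> i _; apply: eq_bigl => z; rewrite /F/= ltn_ord.
  by rewrite prodr_const card_ord.
by apply: big_pred1 => z; rewrite /F/= ltnn.
Qed.

Lemma next_measurable (k : nat) (v : V) : measurable [set w | X k w = v].
Proof. exact: (walk_sample_measurable XY_walk). Qed.

(* Summing over the index of the first public draw gives the geometric series. *)
Lemma pr_step_ge (k : nat) (x : {ffun 'I_k.+1 -> V}) (v : V) : x ord_max \in C ->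
  Pr [set w | path_to k w = x] * transition (x ord_max) v
  <= Pr ([set w | path_to k w = x] `&` [set w | X k.+1 w = v]).
Proof.
move=> xC; have [vpub|vpub] := boolP (v \in pub); last first.
  rewrite transition_out ?mulr0 ?pr_ge0//.
  by apply: contra vpub => /(fintype.subsetP (cluster_sub clusterC)).
set A := [set w | path_to k w = x]; set u := uniform_neighbor e R (x ord_max).
have mA : measurable A by exact: path_to_discrete.
pose q := \sum_(z | z \notin pub) u z; pose p := \sum_(z in pub) u z.
have pq : p + q = 1.
  by rewrite -[RHS](sum_uniform_neighbor _ xC) [RHS](bigID (mem pub)).
have p_gt0 : 0 < p.
  rewrite /p sum_public_neighbor// divr_gt0// lt_def ler0n andbT.
    exact: public_degree_neq0.
  exact: degree_neq0.
have q_ge0 : 0 <= q.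
  by apply: sumr_ge0 => z _; rewrite /u/uniform_neighbor; case: ifP.
pose F m (j : 'I_m.+1) := [pred z | if (j < m)%N then z \notin pub else z == v].
(* On [B m] the first public draw has index [m] and equals [v]; hence these events are disjoint and
   each forces the next sample to be [v]. *)
pose B m := A `&` [set w | draws_to k m.+1 w \in family (F m)].
have mB m : measurable (B m).
  by apply: measurableI => //; apply: discrete_pred; exact: draws_to_discrete.
have BY m w : B m w -> Y k m w = v /\ forall j, (j < m)%N -> Y k j w \notin pub.
  move=> [_ /= /familyP wF]; split=> [|j jm].
    by have := wF ord_max; rewrite ffunE !inE/= ltnn => /eqP.
  by have := wF (Ordinal (ltnW jm : (j < m.+1)%N)); rewrite ffunE !inE/= jm.
have trB : trivIset setT B.
  apply: ltn_trivIset => n m nm; apply/seteqP; split=> // w [/BY[Yn _] /BY[_ Ym]].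
  by have := Ym _ nm; rewrite Yn vpub.
have mAv : measurable (A `&` [set w | X k.+1 w = v]).
  by apply: measurableI => //; exact: next_measurable.
(* The first [N] terms of the geometric series, multiplied through by [p = 1 - q]. *)
have partial N : Pr A * u v * (1 - q ^+ N)
    <= Pr (A `&` [set w | X k.+1 w = v]) * p.
  have -> : 1 - q ^+ N = p * \sum_(i < N) q ^+ i.
    by rewrite -opprB subrX1 -mulNr opprB -[in LHS]pq addrK.
  rewrite mulrCA mulrC ler_wpM2r ?(ltW p_gt0)//.
  have mU : measurable (\big[setU/set0]_(m < N) B m) by exact: bigsetU_measurable.
  apply: le_trans (_ : Pr (\big[setU/set0]_(m < N) B m) <= _); last first.
    apply: pr_le => // w; rewrite -bigcup_mkord => -[m _ Bm].
    have [Ym Yj] := BY _ _ Bm; split=> /=; first by case: Bm.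
    by rewrite (walk_step XY_walk (k := k) (m := m))// Ym.
  rewrite -lee_fin prE// measure_semi_additive_ord//; last first.
    by move=> i j _ _ [w [Bi Bj]]; apply/val_inj/(trB i j) => //; exists w.
  rewrite mulr_sumr -sumEFin le_eqVlt; apply/orP; left; apply/eqP.
  apply: eq_bigr => m _; rewrite -[RHS](prE P (mB m)) (pr_first_public k m x v).
  by rewrite -/A -/u -/q; congr (_%:E); rewrite mulrAC mulrA.
suff : Pr A * u v <= Pr (A `&` [set w | X k.+1 w = v]) * p.
  by rewrite /u uniform_neighborE// -/u -/p mulrA ler_pM2r.
(* Vertices of [C] have a public neighbour, so [q < 1] and [q ^+ N] disappears as [N] grows. *)
have q_lt1 : `|q| < 1 by rewrite ger0_norm// -pq ltrDr.
have lim1 : Pr A * u v * (1 - q ^+ N) @[N --> \oo] --> Pr A * u v * (1 - 0).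
  by apply: cvgM; [exact: cvg_cst|apply: cvgB; [exact: cvg_cst|exact: cvg_expr]].
rewrite -[leLHS]mulr1 -[X in _ * X <= _](subr0 1).
rewrite -(cvg_lim _ lim1)//; apply: limr_le; first by apply/cvg_ex; eexists; exact: lim1.
by apply: nearW => N; exact: partial.
Qed.

(** Both sides have the same total over [v], so the inequalities [pr_step_ge] must all be
    equalities. *)
Lemma markov_property_in (k : nat) (x : {ffun 'I_k.+1 -> V}) (v : V) :
  x ord_max \in C ->
  Pr ([set w | path_to k w = x] `&` [set w | X k.+1 w = v])
  = Pr [set w | path_to k w = x] * transition (x ord_max) v.
Proof.
move=> xC; apply/eqP; rewrite -subr_eq0; apply/eqP.
pose gap u := Pr ([set w | path_to k w = x] `&` [set w | X k.+1 w = u])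
  - Pr [set w | path_to k w = x] * transition (x ord_max) u.
have gap_ge0 u : true -> 0 <= gap u by rewrite subr_ge0 pr_step_ge.
rewrite -/(gap v); apply: (psumr_eq0P gap_ge0) => //.
rewrite sumrB -mulr_sumr sum_transition// mulr1.
rewrite -pr_total ?subrr//; first exact: path_to_discrete.
by move=> u; exact: next_measurable.
Qed.

Definition belast_ffun {k : nat} (x : {ffun 'I_k.+2 -> V}) : {ffun 'I_k.+1 -> V} :=
  [ffun i => x (widen_ord (leqnSn k.+1) i)].

Lemma path_toS (k : nat) (w : Omega) :
  (belast_ffun (path_to k.+1 w), path_to k.+1 w ord_max) = (path_to k w, X k.+1 w).
Proof. by congr (_, _); first apply/ffunP => i; rewrite !ffunE. Qed.

(** The seed is in [C]. Later, either the previous sample is already outside, a null event by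
    induction, or the last step has transition probability zero. *)
Lemma pr_path_out (k : nat) (x : {ffun 'I_k.+1 -> V}) : x ord_max \notin C ->
  Pr [set w | path_to k w = x] = 0.
Proof.
elim: k x => [|k IH] x xC.
  rewrite (_ : [set _ | _] = set0) ?/pr ?measure0//.
  apply/seteqP; split=> // w /= wx; move: xC; rewrite -wx ffunE.
  by rewrite (walk_seed XY_walk).
have mx : measurable [set w | path_to k.+1 w = x] by exact: path_to_discrete.
have mb : measurable [set w | path_to k w = belast_ffun x].
  exact: path_to_discrete.
have sub w : path_to k.+1 w = x -> path_to k w = belast_ffun x /\ X k.+1 w = x ord_max.
  by move=> <-; have [-> ->] := path_toS k w.
apply/eqP; rewrite eq_le pr_ge0 andbT.
have [bC|/IH<-] := boolP (belast_ffun x ord_max \in C); last first.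
  by apply: pr_le => // w /sub[].
rewrite -(mulr0 (Pr [set w | path_to k w = belast_ffun x])).
rewrite -(transition_out (belast_ffun x ord_max) _ xC) -markov_property_in//.
apply: pr_le => //; first by apply: measurableI => //; exact: next_measurable.
Qed.

Lemma markov_property (k : nat) (x : {ffun 'I_k.+1 -> V}) (v : V) :
  Pr ([set w | path_to k w = x] `&` [set w | X k.+1 w = v])
  = Pr [set w | path_to k w = x] * transition (x ord_max) v.
Proof.
have [/markov_property_in //|xC] := boolP (x ord_max \in C).
have mx : measurable [set w | path_to k w = x] by exact: path_to_discrete.
rewrite pr_path_out// mul0r; apply/eqP; rewrite eq_le pr_ge0 andbT.
rewrite -(pr_path_out _ _ xC); apply: pr_le => //.
by apply: measurableI => //; exact: next_measurable.
Qed.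

Lemma walk_in_cluster : {ae P, forall w, forall k, X k w \in C}.
Proof.
apply: ae_foralln => k.
pose Q := [pred x : {ffun 'I_k.+1 -> V} | x ord_max \notin C].
have mQ : measurable [set w | path_to k w \in Q].
  by apply: discrete_pred; exact: path_to_discrete.
exists [set w | path_to k w \in Q]; split => //.
  rewrite -[LHS](prE P mQ) pr_pred; last exact: path_to_discrete.
  by rewrite big1// => x /pr_path_out.
by move=> w /= /negP; rewrite inE /= ffunE.
Qed.

(** * The martingale attached to [g] and its growth *)

Variable g : V -> R.

(** The transition operator applied to [g]: for [v] in [C], the mean of [g] at the sample following
    [v]. *)
Definition drift (v : V) : R := \sum_u transition v u * g u.

(** A function of a deterministic sequence, so that it applies both to sample paths and to the
    values of [path_to]. *)
Definition martingale (k : nat) (x : nat -> V) : R :=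
  \sum_(i < k) (g (x i.+1) - drift (x i)).

Definition increment_bound : R := \sum_u \sum_v `|g u - drift v|.

Lemma increment_le (u v : V) : `|g u - drift v| <= increment_bound.
Proof.
rewrite /increment_bound (bigD1 u)//= (bigD1 v)//= -addrA lerDl.
by rewrite addr_ge0 ?sumr_ge0// => z _; rewrite sumr_ge0.
Qed.

(** Indices above [k] get a default value, which [martingale k] never reads. *)
Definition extend {k : nat} (x : {ffun 'I_k.+1 -> V}) (i : nat) : V := x (inord i).

Lemma martingale_eq (k : nat) (x y : nat -> V) :
  (forall i, (i <= k)%N -> x i = y i) -> martingale k x = martingale k y.
Proof.
by move=> xy; apply: eq_bigr => i _; rewrite !xy// ltnW.
Qed.

Lemma martingale_path (k : nat) (w : Omega) :
  martingale k (extend (path_to k w)) = martingale k (X ^~ w).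
Proof. by apply: martingale_eq => i ik; rewrite /extend ffunE inordK. Qed.

Lemma martingaleS (k : nat) (x : {ffun 'I_k.+2 -> V}) :
  martingale k.+1 (extend x) = martingale k (extend (belast_ffun x))
    + (g (x ord_max) - drift (belast_ffun x ord_max)).
Proof.
rewrite /martingale big_ord_recr/=; congr (_ + (g _ - drift _)).
- apply: martingale_eq => i ik; rewrite /extend ffunE; congr (x _).
  by apply: val_inj; rewrite /= !inordK// ltnS leqW.
- by rewrite /extend; congr (x _); apply: val_inj; rewrite /= inordK.
- by rewrite /extend ffunE; congr (x _); apply: val_inj; rewrite /= inordK.
Qed.

Definition second_moment (k : nat) : R :=
  expect P (path_to k) (fun x => martingale k (extend x) ^+ 2).

(** Orthogonality of martingale increments: given the past, the cross term averages to zero and the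
    squared increment is bounded. *)
Lemma second_momentS (k : nat) :
  second_moment k.+1 <= second_moment k + increment_bound ^+ 2.
Proof.
(* Splits a path into its past and its last sample, the form in which [markov_property] applies. *)
pose h (x : {ffun 'I_k.+2 -> V}) := (belast_ffun x, x ord_max).
pose psi (p : {ffun 'I_k.+1 -> V} * V) :=
  (martingale k (extend p.1) + (g p.2 - drift (p.1 ord_max))) ^+ 2.
have -> : second_moment k.+1 = expect P (path_to k.+1) (psi \o h).
  by apply: eq_bigr => x _; rewrite martingaleS.
rewrite -expect_comp; last exact: path_to_discrete.
have -> : second_moment k + increment_bound ^+ 2 =
    \sum_x (martingale k (extend x) ^+ 2 + increment_bound ^+ 2)
      * Pr [set w | path_to k w = x].
  under [RHS]eq_bigr do rewrite mulrDl.
  rewrite big_split/= -mulr_sumr; congr (_ + _).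
  have := pr_pred P predT (path_to_discrete k); rewrite /= => <-.
  rewrite (_ : [set w | _] = setT) /pr ?probability_setT ?mulr1//.
  by apply/seteqP; split.
rewrite /expect (eq_bigr (fun p => psi (p.1, p.2) * (Pr [set w | path_to k w = p.1]
    * transition (p.1 ord_max) p.2))); last first.
  move=> [x v] _; rewrite -markov_property; congr (_ * pr P _).
  by apply/seteqP; split=> w /=; rewrite /h path_toS => -[-> ->].
rewrite -(pair_bigA _ (fun x v => psi (x, v) * (Pr [set w | path_to k w = x]
    * transition (x ord_max) v)))/=.
apply: ler_sum => x _.
have [xC|xC] := boolP (x ord_max \in C); last first.
  by rewrite pr_path_out// mulr0 big1// => v _; rewrite mul0r mulr0.
set s := martingale k (extend x); set a := x ord_max.
under eq_bigr do rewrite mulrCA.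
rewrite -mulr_sumr mulrC ler_wpM2r ?pr_ge0//.
have centered : \sum_v transition a v * (g v - drift a) = 0.
  under eq_bigr do rewrite mulrBr.
  by rewrite sumrB -mulr_suml sum_transition// mul1r subrr.
have -> : \sum_v psi (x, v) * transition a v
    = s ^+ 2 + \sum_v transition a v * (g v - drift a) ^+ 2.
  transitivity (\sum_v (s ^+ 2 * transition a v
      + 2 * s * (transition a v * (g v - drift a))
      + transition a v * (g v - drift a) ^+ 2)).
    by apply: eq_bigr => v _; rewrite /psi/= -/s -/a; ring.
  by rewrite !big_split/= -!mulr_sumr sum_transition// centered mulr0 addr0 mulr1.
rewrite lerD2l -[leRHS]mul1r -[X in _ <= X * _](sum_transition _ xC) mulr_suml.
apply: ler_sum => v _; rewrite ler_wpM2l ?transition_ge0//.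
rewrite -real_normK ?num_real// ler_sqr ?nnegrE ?increment_le//.
exact: le_trans (increment_le v a).
Qed.

Lemma second_moment_le (k : nat) : second_moment k <= k%:R * increment_bound ^+ 2.
Proof.
elim: k => [|k IH].
  by rewrite mul0r /second_moment /expect big1// => x _;
    rewrite /martingale big_ord0 expr0n mul0r.
by rewrite (le_trans (second_momentS k))// -natr1 mulrDl mul1r lerD2r.
Qed.

Lemma martingale_chebyshev (k : nat) (a : R) : 0 < a ->
  Pr [set w | a <= `|martingale k (X ^~ w)|]
  <= k%:R * increment_bound ^+ 2 / a ^+ 2.
Proof.
move=> a0; rewrite ler_pdivlMr ?exprn_gt0// mulrC.
apply: le_trans (second_moment_le k).
rewrite (_ : [set w | _] = [set w | a ^+ 2 <= martingale k (extend (path_to k w)) ^+ 2]).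
  apply: (markov_expect P _ (path_to_discrete k)) => x; exact: sqr_ge0.
apply/seteqP; split=> w /=; rewrite martingale_path -(real_normK (num_real (martingale _ _))).
  by rewrite ler_sqr ?nnegrE// ltW.
by rewrite ler_sqr ?nnegrE// ltW.
Qed.

Lemma martingale_squares (eps : R) : 0 < eps ->
  {ae P, forall w, \forall n \near \oo,
    `|martingale (n ^ 2) (X ^~ w)| <= eps * (n ^ 2)%:R}.
Proof.
move=> eps0.
(* The shift to [n.+1] keeps the Chebyshev threshold positive. *)
pose F n := [set w | eps * (n.+1 ^ 2)%:R <= `|martingale (n.+1 ^ 2) (X ^~ w)|].
have sq_gt0 n : 0 < (n.+1 ^ 2)%:R :> R by rewrite ltr0n expn_gt0.
have mF n : measurable (F n).
  rewrite (_ : F n = [set w | path_to (n.+1 ^ 2) w \in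
    [pred x | eps * (n.+1 ^ 2)%:R <= `|martingale (n.+1 ^ 2) (extend x)|]]).
    by apply: discrete_pred; exact: path_to_discrete.
  by apply/seteqP; split=> w /=; rewrite inE martingale_path.
pose K := increment_bound ^+ 2 / eps ^+ 2.
have K0 : 0 <= K by rewrite divr_ge0 ?sqr_ge0.
have PF n : Pr (F n) <= K * ((n.+1 ^ 2)%:R)^-1.
  apply: le_trans (martingale_chebyshev _ _ _) _; first exact: mulr_gt0.
  rewrite le_eqVlt; apply/orP; left; apply/eqP; rewrite /K; field.
  by rewrite !gt_eqF//= ltr0n.
have sumF : (\sum_(0 <= n <oo) P (F n) < +oo)%E.
  apply: (@le_lt_trans _ _ (K * 2)%:E); last exact: ltry.
  apply: lime_le; first exact: is_cvg_nneseries.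
  apply: nearW => N; rewrite big_mkord.
  under eq_bigr do rewrite -(prE P (mF _)).
  rewrite sumEFin lee_fin.
  apply: (@le_trans _ _ (\sum_(i < N) K * ((i.+1 ^ 2)%:R)^-1)).
    by apply: ler_sum => i _; exact: PF.
  by rewrite -mulr_sumr ler_wpM2l// sum_inv_sqr_le.
exists (lim_sup_set F); split; last 1 first.
- move=> w /= wF N _ /=; apply: contrapT => NF; apply: wF.
  (* [F n] concerns time [n.+1 ^ 2], so avoiding [F] from [N] on gives the bound from [N.+1] on. *)
  exists N.+1 => //= -[//|n] Nn; rewrite leNgt; apply/negP => wn.
  by apply: NF; exists n => //; exact: ltW.
- apply: bigcap_measurable => // N _.
  by apply: bigcup_measurable => n _; exact: mF.
- exact: lim_sup_set_cvg0.
Qed.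

(** Testing only the countably many values [q.+1%:R^-1] yields a single null set valid for every
    [eps]. *)
Lemma martingale_squares_small : {ae P, forall w, forall eps : R, 0 < eps ->
  \forall n \near \oo, `|martingale (n ^ 2) (X ^~ w)| <= eps * (n ^ 2)%:R}.
Proof.
have : {ae P, forall w, forall q : nat, \forall n \near \oo,
    `|martingale (n ^ 2) (X ^~ w)| <= q.+1%:R^-1 * (n ^ 2)%:R}.
  by apply: ae_foralln => q; apply: martingale_squares; rewrite invr_gt0.
apply: filterS => w wq eps eps0.
pose q := Num.truncn eps^-1; have := wq q; apply: filterS => n.
move/le_trans; apply; rewrite ler_wpM2r// -[leRHS]invrK lef_pV2 ?posrE ?invr_gt0//.
exact/ltW/truncnS_gt.
Qed.

End Walk.

(** * Convergence of the estimator *)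

Theorem lemma4p10 (V : finType) (e : rel V) (pub C : {set V})
    (e_simple : simple_graph e) (e_connected : connected_graph e)
    (C_largest : largest_public_cluster e pub C)
    (C_edge : exists u v : V, induced_edge e C u v)
    (R : realType) (d : measure_display) (Omega : measurableType d)
    (P : probability Omega R)
    (X : nat -> Omega -> V) (Y : nat -> nat -> Omega -> V)
    (XY_walk : designed_random_walk e P pub C X Y) :
  {ae P, forall w : Omega,
    (fun r : nat => avg_degree_estimator e R X r w) @ \oo
      --> avg_degree_limit e R C}.
Proof.
have [e_sym _] := e_simple; have [clusterC _] := C_largest.
have deg_neq0 v : v \in C -> (public_degree e C v)%:R != 0 :> R.
  exact: (public_degree_neq0 e_sym clusterC C_edge).
pose D : R := (total_public_degree e C)%:R.
pose W : R := \sum_(v in C) (public_degree e C v)%:R / (degree e v)%:R.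
have [v0 v0C] : exists v, v \in C by case: C_edge => u [v /and3P[]]; exists u.
have D_neq0 : D != 0.
  rewrite pnatr_eq0 /total_public_degree sum_nat_eq0; apply/negP => /forall_inP.
  by move=> /(_ _ v0C); rewrite -(pnatr_eq0 R) (negPf (deg_neq0 _ v0C)).
have W_neq0 : W != 0.
  apply/eqP => W0.
  have := psumr_eq0P (fun v _ => divr_ge0 (ler0n R _) (ler0n R _)) W0 v0C.
  apply/eqP; rewrite mulf_neq0 ?deg_neq0// invr_eq0.
  exact: (degree_neq0 e_sym clusterC C_edge).
(* The mean of [1 / degree] under the stationary law, proportional to the public-degree; its inverse
   is the claimed limit. *)
pose mu := W / D.
pose f v := (degree e v)%:R^-1 - mu.
(* Weighting [f] by the public-degree makes its total [W - mu * D = 0], and turns the Poisson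
   equation of the walk into one for the symmetric Laplacian. *)
pose h v := if v \in C then (public_degree e C v)%:R * f v else 0.
have [||g gE] := poisson_equation clusterC e_sym (h := h).
- by move=> v /negPf vC; rewrite /h vC.
- rewrite -big_mkcond/=; under eq_bigr do rewrite mulrBr.
  rewrite sumrB -mulr_suml -natr_sum -/(total_public_degree e C) -/D -/W.
  by rewrite /mu mulrC divfK ?subrr.
have fE v : v \in C -> f v = g v - drift (e := e) (C := C) g v.
  move=> vC; apply: (mulfI (deg_neq0 _ vC)); have := gE v; rewrite /h vC => ->.
  under eq_bigr do rewrite mulrBr.
  rewrite sumrB -mulr_suml -public_degree_sum mulrBr; congr (_ - _).
  rewrite mulr_sumr; apply: eq_bigr => u _.
  by rewrite /transition mulrA mulrCA divff ?mulr1 ?deg_neq0.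
have := martingale_squares_small e_sym clusterC C_edge XY_walk g.
have := walk_in_cluster e_sym clusterC C_edge XY_walk.
apply: filterS2 => w XC wM.
pose S r := \sum_(k < r) f (X k w).
(* Replacing [f] by [g - drift g] at each sample, the values of [g] telescope up to the martingale
   increments. *)
have SE r : S r = g (X 0%N w) - g (X r w)
    + martingale (e := e) (C := C) g r (X ^~ w).
  elim: r => [|r IH]; first by rewrite /S /martingale !big_ord0 subrr addr0.
  rewrite /S /martingale !big_ord_recr/= -/(S r) IH fE// /martingale; ring.
have Savg : S r / r%:R @[r --> \oo] --> (0 : R).
  (* The first constant bounds the boundary term [g (X 0) - g (X r)], the second a single step of
     [S]. *)
  apply: (@cvg_div_squares _ _ (\sum_u \sum_v `|g u - g v|) (\sum_v `|f v|)).
  - by apply: sumr_ge0.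
  - move=> k; rewrite /S big_ord_recr/= addrAC subrr add0r.
    by rewrite (bigD1 (X k w))//= lerDl sumr_ge0.
  - move=> eps /wM; apply: filterS => n Mn; rewrite SE addrC.
    rewrite (le_trans (ler_normD _ _))// lerD//.
    rewrite (bigD1 (X 0%N w))//= (bigD1 (X (n ^ 2)%N w))//= -addrA lerDl.
    by rewrite addr_ge0 ?sumr_ge0// => u _; rewrite sumr_ge0.
have -> : avg_degree_limit e R C = (0 + mu)^-1.
  by rewrite add0r /mu invf_div.
have : (S r / r%:R + mu)^-1 @[r --> \oo] --> (0 + mu)^-1.
  apply: cvgV; first by rewrite add0r mulf_neq0 ?invr_eq0.
  by apply: cvgD => //; exact: cvg_cst.
(* The estimator equals the inverse of [S r / r + mu] only for [r > 0], hence the eventual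
   equality. *)
apply: cvg_trans; apply: near_eq_cvg; near=> r.
rewrite /avg_degree_estimator -[RHS]invf_div; congr (_^-1).
rewrite /S sumrB sumr_const card_ord mulrBl -[mu *+ r]mulr_natr mulfK ?subrK//.
by rewrite pnatr_eq0 -lt0n; near: r; exact: nbhs_infty_gt.
Unshelve. all: by end_near.
Qed.
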